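(* Let $n>2$ be an integer and $r\ge1$ an integer with $2^r+1<2^n$, let $s_i=(2^r+1)2^{n+i}+1$ for $i\in\mathbb{N}$, and let $S=P_{2^r+1}(n)$. Then the set of maximal elements of $\mathrm{Ap}(S,s_0)$ with respect to $\le_S$ is $$\{2s_i+s_{i+1}+\dots+s_{n+r-1}\mid 1\le i\le r\}\cup\{2s_j+s_{j+1}+\dots+s_{n-1}+s_{n+r}\mid 1\le j\le n-2\}\cup\{2s_1+s_n+s_{n+r}\}.$$
   Context: $P_{2^r+1}(n)$ is the numerical semigroup consisting of all finite non-negative integer linear combinations of $\{(2^r+1)2^{n+i}+1\mid i\in\mathbb{N}\}$. For nonzero $m\in S$, $\mathrm{Ap}(S,m)=\{s\in S\mid s-m\notin S\}$. The order $\le_S$ on $\mathbb{Z}$ is defined by $a\le_S b$ iff $b-a\in S$. *)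

(* Defs.v *)
From mathcomp Require Import all_boot all_order all_algebra.
From mathcomp Require Import classical_sets.
Set Implicit Arguments.
Unset Strict Implicit.
Unset Printing Implicit Defensive.
Import Order.TTheory GRing.Theory Num.Theory.
Local Open Scope classical_set_scope.
Local Open Scope ring_scope.

(* Semigroups are taken as subsets of int, so that s - m in the Apery set and
   b - a in the order <=_S are genuine (untruncated) differences. *)

Definition nat_span (A : set int) : set int :=
  [set x | exists (k : nat) (a : 'I_k -> int) (c : 'I_k -> nat),
     (forall i, A (a i)) /\ x = \sum_(i < k) (c i)%:Z * a i].

Definition sgen (b n i : nat) : int := (b * 2 ^ (n + i) + 1)%N%:Z.

Definition Psemigroup (b n : nat) : set int :=
  nat_span [set x | exists i : nat, x = sgen b n i].

Definition Apery (S : set int) (m : int) : set int :=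
  [set s | S s /\ ~ S (s - m)].

Definition leS (S : set int) (a b : int) : Prop := S (b - a).

Definition maximal_elements (le : int -> int -> Prop) (A : set int) : set int :=
  [set x | A x /\ forall y, A y -> le x y -> y = x].

(* Main.v *)
(** Write [q = (2^r + 1) 2^n], so that [s_i = q 2^i + 1]. A sum of [N] generators
    is [q V + N] with [V] a sum of [N] powers of two, which is possible exactly
    when [popcount V <= N <= V]. With [d = V - N] and
    [f V = V - popcount V], the 2-adic valuation of [V!], this reads
    [S = { (q + 1) V - d | d <= f V }]; the Apery set of [s_0 = q + 1] has one
    element for each [d <= q], obtained by taking [V] minimal with [d <= f V].
    Put [e = f V - d]. Then [2^(e+1)] divides [V], and adding [s_i] to the
    element stays in the Apery set iff [e < i] and [d + 2^i - 1 <= q]. Hence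
    the element is maximal iff [q + 1 < d + 2^(e+1)]. As [q] has just the two
    binary digits [n + r] and [n], this leaves only [V = 2^(n+r)], [V = q] and
    [V = q + 4], the three families of the statement. *)

Require Import Defs.
From mathcomp Require Import all_boot all_order all_algebra.
From mathcomp Require Import classical_sets.
From mathcomp Require Import zify ring.
Import GRing.Theory.
Local Open Scope classical_set_scope.
Local Open Scope ring_scope.

(** * The 2-adic valuation of factorials *)

Definition vfact2 (V : nat) : nat := logn 2 V`!.

Lemma vfact2S V : vfact2 V.+1 = (vfact2 V + logn 2 V.+1)%N.
Proof. by rewrite /vfact2 factS lognM ?fact_gt0 // addnC. Qed.

Lemma vfact2_0 : vfact2 0 = 0%N. Proof. by rewrite /vfact2 logn1. Qed.

Lemma vfact2_1 : vfact2 1 = 0%N. Proof. by rewrite /vfact2 logn1. Qed.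

Lemma vfact2_double V : vfact2 V.*2 = (V + vfact2 V)%N.
Proof.
elim: V => [|V IH]; first by rewrite vfact2_0.
rewrite doubleS !vfact2S IH -doubleS.
have -> : logn 2 V.*2.+1 = 0%N by rewrite lognE /= dvdn2 /= odd_double.
have -> : logn 2 V.+1.*2 = (1 + logn 2 V.+1)%N.
  by rewrite -mul2n lognM // logn_prime.
lia.
Qed.

Lemma vfact2_doubleS V : vfact2 V.*2.+1 = (V + vfact2 V)%N.
Proof.
by rewrite vfact2S vfact2_double lognE /= dvdn2 /= odd_double addn0.
Qed.

(** Multiplication by [2 ^ a] preserves the binary digit sum [V - vfact2 V]; the additive form
    avoids truncated subtraction. *)
Lemma vfact2_pow a U : (vfact2 (2 ^ a * U) + U = 2 ^ a * U + vfact2 U)%N.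
Proof.
elim: a => [|a IH]; first by rewrite !mul1n addnC.
rewrite expnS -mulnA mul2n vfact2_double -addnn; lia.
Qed.

Lemma vfact2_exp2 a : (vfact2 (2 ^ a) + 1 = 2 ^ a)%N.
Proof. by have := vfact2_pow a 1; rewrite muln1 vfact2_1 addn0. Qed.

Lemma vfact2_homo V W : (V <= W)%N -> (vfact2 V <= vfact2 W)%N.
Proof.
move=> VW; rewrite -(subnK VW) addnC.
by elim: (W - V)%N => [|k IH]; rewrite ?addn0 // addnS vfact2S; lia.
Qed.

Lemma half_le_vfact2 V : (V <= (vfact2 V).*2.+1)%N.
Proof.
have := odd_double_half V; move: (V./2) => h.
by case: (odd V) => <-; rewrite ?add1n ?add0n ?vfact2_doubleS ?vfact2_double; lia.
Qed.

Lemma vfact2_le V : (vfact2 V <= V.-1)%N.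
Proof.
elim/ltn_ind: V => -[|V] IH; first by rewrite vfact2_0.
have := odd_double_half V.+1; move: (V.+1./2) => h.
have [hV|Vh] := ltnP h V.+1; last by case: (odd _); lia.
have := IH h hV.
by case: (odd _) => ? <-; rewrite ?add1n ?add0n ?vfact2_doubleS ?vfact2_double; lia.
Qed.

(** The gap between the two sides is the 2-adic valuation of a binomial coefficient. *)
Lemma vfact2D V W : (vfact2 V + vfact2 W <= vfact2 (V + W))%N.
Proof.
have /(congr1 (logn 2)) := bin_fact (leq_addr W V).
rewrite addKn !lognM ?muln_gt0 ?fact_gt0 ?bin_gt0 ?leq_addr // /vfact2; lia.
Qed.

(* Adding [2 ^ a - 1] to a multiple of [2 ^ a] causes no binary carry. *)
Lemma vfact2_fill a V : (2 ^ a %| V)%N ->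
  (vfact2 (V + 2 ^ a).-1 + a + 1 = vfact2 V + 2 ^ a)%N.
Proof.
move=> /dvdnP [U ->]; rewrite [(U * _)%N]mulnC -mulnSr.
have := vfact2_pow a U.+1; have := vfact2_pow a U.
have a0 : (0 < 2 ^ a * U.+1)%N by rewrite muln_gt0 expn_gt0.
have := vfact2S (2 ^ a * U.+1).-1; rewrite prednK // => ->.
rewrite vfact2S lognM ?expn_gt0 // pfactorK // mulnS; lia.
Qed.

(** For [V > 0], [vfact2] jumps by [logn 2 V] from [V - 1] to [V], and by minimality this jump
    starts below [d]. *)
Lemma dvdn_first_vfact2 V d : (d <= vfact2 V)%N ->
  (forall W, (W < V)%N -> (vfact2 W < d)%N) -> (2 ^ (vfact2 V - d).+1 %| V)%N.
Proof.
case: V => [|V] dV minV; first by rewrite dvdn0.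
rewrite pfactor_dvdn //; have := minV V (ltnSn _); move: dV.
by rewrite vfact2S; lia.
Qed.

Lemma pow2_sum_of_vfact2 V d : (d <= vfact2 V)%N ->
  exists l : seq nat, V = (\sum_(i <- l) 2 ^ i)%N /\ V = (d + size l)%N.
Proof.
elim/ltn_ind: V d => V IH d; case: V IH => [|V] IH dV.
  by exists [::]; rewrite big_nil; move: dV; rewrite vfact2_0 /=; lia.
have := odd_double_half V.+1; set h := (V.+1)./2; case: (odd _) => eV.
  have dh : (d <= vfact2 h.*2)%N.
    by rewrite vfact2_double -vfact2_doubleS -add1n eV.
  case: (IH h.*2 _ d dh) => [|l [e1 e2]]; first lia.
  by exists (0%N :: l); rewrite big_cons /= -e1; lia.
rewrite add0n in eV; rewrite -eV vfact2_double in dV.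
(* For [V = 2h]: if [h <= d], double every term of a decomposition of [h] with defect [d - h];
   otherwise split off two ones, since [vfact2 (2(h - 1)) >= h - 1 >= d]. *)
have [hd|dh] := leqP h d.
  case: (IH h _ (d - h)%N) => [||l [e1 e2]]; [lia|lia|].
  exists [seq i.+1 | i <- l]; rewrite big_map size_map.
  under eq_bigr do rewrite expnS.
  by rewrite -big_distrr /= -e1; lia.
case: (IH (h.-1).*2 _ d) => [||l [e1 e2]]; [lia|rewrite vfact2_double; lia|].
by exists [:: 0%N, 0%N & l]; rewrite !big_cons /= -e1; lia.
Qed.

(** * Membership, Apery set and maximal elements for arbitrary [b] *)

Section Semigroup.
Variables b n : nat.
Let q := (b * 2 ^ n)%N.
Let S := Psemigroup b n.

Lemma sgenE i : sgen b n i = (q * 2 ^ i + 1)%N%:Z.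
Proof. by rewrite /sgen /q expnD mulnA. Qed.

(** Such values are closed under addition because [vfact2] is superadditive, and [V = 2 ^ t],
    [d = 2 ^ t - 1] gives a generator. Conversely, [V] splits into [V - d] powers of two. *)
Lemma PsemigroupP x : S x <->
  exists V d : nat, (d <= vfact2 V)%N /\ x = q.+1%:Z * V%:Z - d%:Z.
Proof.
split; last first.
  move=> [V [d [dV ->]]]; have [l [e1 e2]] := pow2_sum_of_vfact2 _ _ dV.
  exists (size l), (fun i => sgen b n (nth 0%N l i)), (fun=> 1%N).
  split=> [i|]; first by exists (nth 0%N l i).
  have -> : q.+1%:Z * V%:Z - d%:Z = q%:Z * V%:Z + (size l)%:Z.
    by move: (size l) e2 => N e2; rewrite -addn1 PoszD; lia.
  rewrite {}e1 {e2 dV}.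
  rewrite -(big_mkord xpredT (fun i => 1%:Z * sgen b n (nth 0%N l i))).
  rewrite -(big_nth 0%N xpredT (fun i => 1%:Z * sgen b n i)).
  elim: l => [|i l IH]; first by rewrite !big_nil /=; lia.
  by rewrite !big_cons -IH sgenE /=; lia.
move=> [k [a [c [ha ->]]]].
pose P (x : int) := exists V d : nat,
  (d <= vfact2 V)%N /\ x = q.+1%:Z * V%:Z - d%:Z.
have PD u v : P u -> P v -> P (u + v).
  move=> [V [d [dV ->]]] [W [e [eW ->]]]; exists (V + W)%N, (d + e)%N; split.
    by have := vfact2D V W; lia.
  by rewrite !PoszD; ring.
have P0 : P 0 by exists 0%N, 0%N; rewrite mulr0.
apply: (big_ind P) => // i _.
elim: (c i) => [|j IH]; first by rewrite mul0r.
rewrite -addn1 PoszD mulrDl mul1r; apply: PD => //.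
case: (ha i) => t ->; exists (2 ^ t)%N, (2 ^ t - 1)%N.
have := vfact2_exp2 t; rewrite sgenE; move: (2 ^ t)%N => T eT.
by split; lia.
Qed.

Lemma PsemigroupD x y : S x -> S y -> S (x + y).
Proof.
move=> /PsemigroupP [V [d [dV ->]]] /PsemigroupP [W [e [eW ->]]].
apply/PsemigroupP; exists (V + W)%N, (d + e)%N; split.
  by have := vfact2D V W; lia.
by rewrite !PoszD; ring.
Qed.

Lemma Psemigroup_sgen i : S (sgen b n i).
Proof.
apply/PsemigroupP; exists (2 ^ i)%N, (2 ^ i - 1)%N; rewrite sgenE.
by have := vfact2_exp2 i; move: (2 ^ i)%N => T eT; split; lia.
Qed.

(** This reduces the test for maximality to adding a single generator. *)
Lemma Psemigroup_sub_sgen x : S x -> x != 0 -> exists i, S (x - sgen b n i).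
Proof.
move=> [k [a [c [ha ->]]]] nz.
have /existsP [i ci] : [exists i, c i != 0%N].
  apply: contraR nz; rewrite negb_exists => /forallP c0; apply/eqP.
  by apply: big1 => i _; have := c0 i; rewrite negbK => /eqP ->; rewrite mul0r.
have [t at_] := ha i; exists t; rewrite -at_.
exists k, a, (fun j => (c j - (j == i))%N); split=> //.
rewrite (bigD1 i) //= [RHS](bigD1 i) //= eqxx.
rewrite (eq_bigr (fun j => (c j - (j == i))%N%:Z * a j)) => [|j /negbTE ->].
  by move: (\sum_(j | _) _) => z; case: (c i) ci => // u _; rewrite subn1 /=; lia.
by rewrite subn0.
Qed.

Lemma Psemigroup_sub_sgen0 V d : (d <= vfact2 V)%N -> (q < d)%N ->
  S (q.+1%:Z * V%:Z - d%:Z - sgen b n 0).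
Proof.
move=> dV qd; apply/PsemigroupP.
have := vfact2_le V; have := divn_eq d q.+1; have := ltn_pmod d (ltn0Sn q).
have : (0 < d %/ q.+1)%N by rewrite divn_gt0.
move: (d %/ _)%N (d %% _)%N => k e k0 eq dE Vle.
have kq : (q <= k * q)%N by rewrite leq_pmull.
rewrite mulnS in dE.
(* From [d < V] follows [V - 1 - k >= k * q + e >= 2 * e], and [vfact2] is at least half of its
   argument, rounded down. *)
exists (V - 1 - k)%N, e; split; first by have := half_le_vfact2 (V - 1 - k); lia.
have -> : (V - 1 - k)%N%:Z = V%:Z - 1 - k%:Z by lia.
by rewrite sgenE expn0 muln1 addn1 dE -addn1 !PoszD PoszM; ring.
Qed.

Lemma Apery_PsemigroupP x : Apery S (sgen b n 0) x <->
  exists V d : nat, [/\ (d <= q)%N, (d <= vfact2 V)%N,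
    (forall W, (W < V)%N -> (vfact2 W < d)%N) & x = q.+1%:Z * V%:Z - d%:Z].
Proof.
split=> [[/PsemigroupP [V [d [dV ->]]] nS]|[V [d [dq dV minV ->]]]].
  exists V, d; split=> //.
    by rewrite leqNgt; apply/negP => qd; apply: nS; apply: Psemigroup_sub_sgen0.
  move=> W WV; rewrite ltnNge; apply/negP => dW; apply: nS; apply/PsemigroupP.
  exists V.-1, d; split; first by apply: leq_trans dW (vfact2_homo _ _ _); lia.
  have -> : V.-1%:Z = V%:Z - 1 by lia.
  by rewrite sgenE expn0 muln1 addn1; ring.
split; first by apply/PsemigroupP; exists V, d.
move=> /PsemigroupP [W [e [eW]]]; rewrite sgenE expn0 muln1 addn1 => E.
have {}E : (q.+1 * V + e = q.+1 * W.+1 + d)%N by lia.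
have eW1 : (e <= W.-1)%N by apply: leq_trans eW (vfact2_le W).
(* If [W < V], then [d <= q] forces [W = V - 1] and [e = d], against minimality. If [W >= V], then
   [e < W] forces [V > d + q], while minimality gives [V <= 2 * d]. *)
have [WV|VW] := ltnP W V.
  have [k Vk] : exists k, V = (W.+1 + k)%N by exists (V - W.+1)%N; lia.
  have := minV _ WV; case: k Vk => [|k] Vk; move: E; rewrite Vk ?mulnDr ?mulnS; lia.
have [k Wk] : exists k, W = (V + k)%N by exists (W - V)%N; lia.
have eE : (e = d + k.+1 * q + k.+1)%N by move: E; rewrite Wk; lia.
case: V dV minV {E VW} Wk => [|V] dV minV Wk; first by lia.
by have := minV V (ltnSn _); have := half_le_vfact2 V; nia.
Qed.

(** With [e = vfact2 V - d], if any generator can be added inside the Apery set, then the one of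
    index [e + 1] can, so a single inequality decides. *)
Lemma maximal_Apery_PsemigroupP x :
  maximal_elements (leS S) (Apery S (sgen b n 0)) x <->
  exists V d : nat, [/\ (d <= q)%N, (d <= vfact2 V)%N,
    (forall W, (W < V)%N -> (vfact2 W < d)%N),
    (q.+1 < d + 2 ^ (vfact2 V - d).+1)%N & x = q.+1%:Z * V%:Z - d%:Z].
Proof.
have shift V d i : q.+1%:Z * V%:Z - d%:Z + sgen b n i =
    q.+1%:Z * (V + 2 ^ i)%N%:Z - (d + 2 ^ i - 1)%N%:Z.
  have : (0 < 2 ^ i)%N by rewrite expn_gt0.
  by rewrite sgenE; move: (2 ^ i)%N => T T0; lia.
have supadd V d i : (d <= vfact2 V -> d + 2 ^ i - 1 <= vfact2 (V + 2 ^ i))%N.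
  by have := vfact2D V (2 ^ i); have := vfact2_exp2 i; lia.
split=> [[/Apery_PsemigroupP [V [d [dq dV minV ->]]] mx]|].
  exists V, d; split=> //; rewrite ltnNge; apply/negP => le.
  have := vfact2_fill _ _ (dvdn_first_vfact2 _ _ dV minV); have := shift V d (vfact2 V - d).+1.
  have := supadd V d (vfact2 V - d).+1 dV.
  set i := (_ - _).+1 in le *; set y := _ + _ => sa yE fl.
  suff yA : Apery S (sgen b n 0) y.
    have /(mx _ yA) : leS S (q.+1%:Z * V%:Z - d%:Z) y.
      by rewrite /leS /y addrAC subrr add0r; apply: Psemigroup_sgen.
    by rewrite /y sgenE; lia.
  apply/Apery_PsemigroupP; exists (V + 2 ^ i)%N, (d + 2 ^ i - 1)%N; split=> //.
    by lia.
  (* By [vfact2_fill], [vfact2 (V + 2 ^ i - 1)] is exactly [d + 2 ^ i - 2], one below the new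
     defect. *)
  move=> W WV; apply: (@leq_ltn_trans (vfact2 (V + 2 ^ i).-1)).
    by apply: vfact2_homo; lia.
  by rewrite /i in fl *; lia.
move=> [V [d [dq dV minV lt ->]]]; set x0 := _ - _.
have Ax : Apery S (sgen b n 0) x0 by apply/Apery_PsemigroupP; exists V, d.
split=> // y [Sy nSy] xy; apply/eqP; rewrite -subr_eq0; apply/negPn/negP => nz.
have [i Si] := Psemigroup_sub_sgen _ xy nz; apply: nSy.
have -> : y - sgen b n 0 = y - x0 - sgen b n i + (x0 + sgen b n i - sgen b n 0).
  by ring.
apply: PsemigroupD => //; rewrite /x0 shift.
(* For [i > e] the new defect exceeds [q]; for [i <= e] it is already reached by [V + 2 ^ i - 1].
   Either way [sgen b n 0] can be subtracted. *)
have [di|id] := ltnP (vfact2 V - d) i.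
  apply: Psemigroup_sub_sgen0; first exact: supadd.
  have : (2 ^ (vfact2 V - d).+1 <= 2 ^ i)%N by rewrite leq_exp2l.
  by lia.
apply/PsemigroupP; exists (V + 2 ^ i).-1, (d + 2 ^ i - 1)%N; split.
  have iV : (2 ^ i %| V)%N.
    by apply: dvdn_trans (dvdn_first_vfact2 _ _ dV minV); rewrite dvdn_exp2l // leqW.
  by have := vfact2_fill _ _ iV; lia.
have T0 : (0 < 2 ^ i)%N by rewrite expn_gt0.
have -> : (V + 2 ^ i).-1%:Z = (V + 2 ^ i)%N%:Z - 1 by lia.
by rewrite sgenE expn0 muln1 addn1; ring.
Qed.

(** The powers telescope: [2 * 2 ^ i + 2 ^ (i + 1) + ... + 2 ^ (t - 1) = 2 ^ t], with [t - i + 1]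
    terms. *)
Lemma sgen_chain i t : (i < t)%N ->
  2 * sgen b n i + \sum_(i.+1 <= k < t) sgen b n k =
  (q * 2 ^ t + (t - i + 1))%N%:Z.
Proof.
move=> it; rewrite -(subnKC it).
elim: (t - i.+1)%N => [|k IH].
  by rewrite addn0 big_geq // sgenE expnS; lia.
rewrite addnS big_nat_recr /=; last by lia.
rewrite addrA IH sgenE (expnS 2 (i.+1 + k)); lia.
Qed.

End Semigroup.

(** * Solving the maximality conditions when [q] has two binary digits *)

Section TwoBits.
Variables n r : nat.
Hypotheses (n_gt2 : (2 < n)%N) (r_gt0 : (1 <= r)%N).
Let q := ((2 ^ r + 1) * 2 ^ n)%N.

Lemma two_bitsE : q = (2 ^ (n + r) + 2 ^ n)%N.
Proof. by rewrite /q mulnDl mul1n expnD mulnC. Qed.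

Lemma vfact2_two_bits : (vfact2 q + 2 = q)%N.
Proof.
have := vfact2_pow n (2 ^ r + 1); rewrite mulnC -/q.
have : (vfact2 (2 ^ r + 1) + 1 = 2 ^ r)%N.
  have <- : vfact2 (2 ^ r) = vfact2 (2 ^ r + 1); last exact: vfact2_exp2.
  rewrite addn1 vfact2S lognE /= dvdn2 /= oddX.
  by case: r r_gt0 => // ? _; rewrite addn0.
lia.
Qed.

Lemma logn_two_bits : logn 2 q = n.
Proof.
rewrite /q lognM ?expn_gt0 ?addn1 // pfactorK //.
by rewrite lognE /= dvdn2 /= oddX; case: r r_gt0.
Qed.

(** As [8] divides [q], both [q + 2] and [q + 4] have digit sum 3. This bounds [V] by [q + 4]. *)
Lemma vfact2_two_bits_add :
  (vfact2 (q + 2) + 1 = q)%N /\ (vfact2 (q + 4) = q + 1)%N.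
Proof.
have [k qk] : exists k, q = (k.*2.*2)%N.
  exists (((2 ^ r + 1) * 2 ^ (n - 3)).*2)%N.
  by rewrite /q -{1}(subnK n_gt2) expnD mulnA; lia.
have qE := vfact2_two_bits; have q8 : ~~ odd k.
  suff : (8 %| q)%N by rewrite qk; lia.
  by rewrite /q dvdn_mull // (@dvdn_exp2l 2 3).
rewrite -(even_halfK q8) in qk; move: (k./2) qk => h qk.
have e2 : (q + 2 = h.*2.*2.+1.*2)%N by lia.
have e4 : (q + 4 = h.*2.+1.*2.*2)%N by lia.
move: qE; rewrite e2 e4 qk.
by rewrite !(vfact2_double, vfact2_doubleS); lia.
Qed.

Lemma maximal_two_bitsP V d :
  [/\ (d <= q)%N, (d <= vfact2 V)%N, (forall W, (W < V)%N -> (vfact2 W < d)%N)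
    & (q.+1 < d + 2 ^ (vfact2 V - d).+1)%N] <->
  [\/ V = (2 ^ (n + r))%N /\
        exists i, (1 <= i <= r)%N /\ (d + (n + r - i + 1) = 2 ^ (n + r))%N,
      V = q /\ exists j, (1 <= j <= n - 2)%N /\ (d + (n - j + 2) = q)%N
    | V = (q + 4)%N /\ d = q].
Proof.
have fq := vfact2_two_bits; have lq := logn_two_bits.
have [fq2 fq4] := vfact2_two_bits_add; have qE := two_bitsE.
have fB := vfact2_exp2 (n + r).
have n_lt : (n < 2 ^ n)%N by apply: ltn_expl.
have B_gt : (n + r < 2 ^ (n + r))%N by apply: ltn_expl.
split.
  move=> [dq dV minV lt].
  have dvdV := dvdn_first_vfact2 _ _ dV minV.
  have VqS : (V <= q + 4)%N.
    by rewrite leqNgt; apply/negP => /minV; lia.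
  have dV1 := vfact2_le V.
  have evenV : (2 %| V)%N by apply: dvdn_trans dvdV; rewrite expnS dvdn_mulr.
  have evenq : (2 %| q)%N.
    by rewrite /q dvdn_mull // (@dvdn_exp2l 2 1); lia.
  have [Vq|qV|Vq] := ltngtP V q; last 2 first.
  - have [V2|V4] : V = (q + 2)%N \/ V = (q + 4)%N by lia.
      move: dvdV lt dV; rewrite V2; case E: (vfact2 _ - d)%N => [|e]; first by lia.
      move=> dvdV _ _; exfalso.
      have : (4 %| q + 2)%N.
        by apply: dvdn_trans dvdV; rewrite (@dvdn_exp2l 2 2).
      have : (4 %| q)%N by rewrite /q dvdn_mull // (@dvdn_exp2l 2 2) // ltnW.
      by lia.
    apply: Or33; split=> //; have := minV (q + 2)%N; lia.
  - apply: Or32; split=> //; rewrite Vq in dvdV lt dV.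
    move: dvdV; rewrite pfactor_dvdn ?lq //; last by lia.
    have dE : (d + (vfact2 q - d) + 2 = q)%N by lia.
    move: (vfact2 q - d)%N dE lt => e dE lt en.
    (* Here [d = q - 2 - e], so the inequality reads [e + 3 < 2 ^ e.+1]; the index is
       [j = n - e]. *)
    have e2 : (2 <= e)%N by case: e dE lt {en} => [|[|e]] //=; lia.
    by exists (n - e)%N; lia.
  (* Strictly below [2 ^ (n + r)], or strictly between it and [q], divisibility leaves a distance of
     at least [2 ^ e.+1] to the next of these two numbers. Then [d + 2 ^ e.+1 <= q], a
     contradiction. Larger [e] violates divisibility of [V], or needs [V = 0], where [e = 0]. *)
  have [VB|BV|VB] := ltngtP V (2 ^ (n + r)).
  - exfalso; have [le|gt] := leqP (vfact2 V - d).+1 (n + r).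
      have : (2 ^ (vfact2 V - d).+1 %| 2 ^ (n + r) - V)%N.
        by apply: dvdn_sub => //; apply: dvdn_exp2l.
      by move/dvdn_leq; lia.
    have : (2 ^ (n + r) <= 2 ^ (vfact2 V - d).+1)%N by rewrite leq_exp2l // ltnW.
    case: (posnP V) => [V0|V0]; first by rewrite V0 vfact2_0 in gt; lia.
    by have := dvdn_leq V0 dvdV; lia.
  - exfalso; have [le|gt] := leqP (vfact2 V - d).+1 n.
      have : (2 ^ (vfact2 V - d).+1 %| q - V)%N.
        by apply: dvdn_sub => //; rewrite /q dvdn_mull // dvdn_exp2l.
      by move/dvdn_leq; lia.
    have : (2 ^ n %| V - 2 ^ (n + r))%N.
      apply: dvdn_sub; last by rewrite dvdn_exp2l // leq_addr.
      by apply: dvdn_trans dvdV; rewrite dvdn_exp2l // ltnW.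
    by move/dvdn_leq; lia.
  apply: Or31; split=> //; rewrite VB in dvdV lt dV.
  rewrite dvdn_Pexp2l // in dvdV.
  have dE : (d + (vfact2 (2 ^ (n + r)) - d) + 1 = 2 ^ (n + r))%N by lia.
  move: (vfact2 _ - d)%N dE lt dvdV => e dE lt en.
  have ne : (n <= e)%N.
    rewrite leqNgt; apply/negP => en'.
    have : (2 ^ e.+1 <= 2 ^ n)%N by rewrite leq_exp2l.
    by lia.
  by exists (n + r - e)%N; lia.
(* By monotonicity, minimality need only be checked at the predecessor. *)
have min V' d' : (0 < V')%N -> (vfact2 V'.-1 < d')%N ->
    forall W, (W < V')%N -> (vfact2 W < d')%N.
  by move=> V0 lt W WV; apply: leq_ltn_trans lt; apply: vfact2_homo; lia.
have pred V' : (0 < V')%N -> vfact2 V' = (vfact2 V'.-1 + logn 2 V')%N.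
  by case: V' => // U _; rewrite vfact2S.
case=> [[-> [i [ir dE]]]|[-> [j [jn dE]]]|[-> ->]].
- have B0 : (0 < 2 ^ (n + r))%N by lia.
  have := pred _ B0; rewrite pfactorK // => pB.
  split; [lia|lia|apply: min; lia|].
  have -> : (vfact2 (2 ^ (n + r)) - d = n + r - i)%N by lia.
  have e1 : (2 ^ n <= 2 ^ (n + r - i))%N by rewrite leq_exp2l //; lia.
  (* For [e = n + r - i > 2] this yields [2 ^ e >= 2 * e > e + 2], so [2 ^ e.+1 > 2 ^ n + e + 2]. *)
  have : (n + r - i - 1 < 2 ^ (n + r - i - 1))%N by apply: ltn_expl.
  have : (2 ^ (n + r - i) = 2 * 2 ^ (n + r - i - 1))%N.
    by rewrite -expnS; congr (_ ^ _)%N; lia.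
  by rewrite expnS; lia.
- have q0 : (0 < q)%N by lia.
  have := pred _ q0; rewrite lq => pq.
  split; [lia|lia|apply: min; lia|].
  have -> : (vfact2 q - d = n - j)%N by lia.
  have : (n - j < 2 ^ (n - j))%N by apply: ltn_expl.
  by rewrite expnS; lia.
have e4 : (0 < q + 4)%N by lia.
have f3 : vfact2 (q + 3) = vfact2 (q + 2).
  rewrite addnS vfact2S lognE /= dvdn2 /= oddD /= /q oddM oddX.
  by case: n n_gt2 => // ? _; rewrite andbF addn0.
split; [lia|lia|apply: min => //|].
  by rewrite addnS /= f3; lia.
have -> : (vfact2 (q + 4) - q = 1)%N by lia.
by rewrite /=; lia.
Qed.

End TwoBits.

(** * The three families as values [q * V + N] *)

Theorem theorem7 (n r : nat) (hn : (2 < n)%N) (hr : (1 <= r)%N)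
    (hrn : (2 ^ r + 1 < 2 ^ n)%N) :
  let s : nat -> int := sgen (2 ^ r + 1)%N n in
  let S : set int := Psemigroup (2 ^ r + 1)%N n in
  maximal_elements (leS S) (Apery S (s 0%N)) =
    [set x : int | exists i : nat, (1 <= i <= r)%N /\
       x = 2 * s i + \sum_(i.+1 <= k < (n + r)%N) s k]
    `|` [set x : int | exists j : nat, (1 <= j <= n - 2)%N /\
       x = 2 * s j + \sum_(j.+1 <= k < n) s k + s (n + r)%N]
    `|` [set 2 * s 1%N + s n + s (n + r)%N].
Proof.
move=> s S; set b := (2 ^ r + 1)%N.
have B1 i : (1 <= i <= r)%N -> 2 * s i + \sum_(i.+1 <= k < (n + r)%N) s k =
    (b * 2 ^ n * 2 ^ (n + r) + (n + r - i + 1))%N%:Z.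
  by move=> ir; apply: sgen_chain; lia.
have B2 j : (1 <= j <= n - 2)%N ->
    2 * s j + \sum_(j.+1 <= k < n) s k + s (n + r)%N =
    (b * 2 ^ n * (b * 2 ^ n) + (n - j + 2))%N%:Z.
  (* The chain contributes [2 ^ n] to [V] and the last generator [2 ^ (n + r)]; together they make
     [q]. *)
  move=> jn; rewrite [X in X + _]sgen_chain; last by lia.
  rewrite /s sgenE -/b {4}/b mulnDl mul1n [(2 ^ r * _)%N]mulnC -expnD.
  by move: (2 ^ (n + r))%N => B; lia.
have B3 : 2 * s 1%N + s n + s (n + r)%N =
    (b * 2 ^ n * (b * 2 ^ n + 4) + 4)%N%:Z.
  rewrite /s !sgenE -/b {5}/b mulnDl mul1n [(2 ^ r * _)%N]mulnC -expnD.
  by move: (2 ^ (n + r))%N => B; lia.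
rewrite -/b in B1 B2 B3 *.
set q := (b * 2 ^ n)%N in B1 B2 B3.
(* [N = V - d] is the number of generators in the sum. *)
have VdN V d N : (d + N = V)%N -> q.+1%:Z * V%:Z - d%:Z = (q * V + N)%N%:Z.
  by move=> <-; lia.
rewrite eqEsubset; split=> x.
  move=> /maximal_Apery_PsemigroupP [V [d [h1 h2 h3 h4 ->]]].
  have /(maximal_two_bitsP _ _ hn hr) : [/\ _, _, _ & _] := And4 h1 h2 h3 h4.
  case=> [[-> [i [ir dE]]]|[-> [j [jn dE]]]|[-> ->]].
  - by left; left; exists i; split=> //; rewrite B1 //; apply: VdN.
  - by left; right; exists j; split=> //; rewrite B2 //; apply: VdN.
  - by right; rewrite /= B3; apply: VdN.
move=> H; apply/maximal_Apery_PsemigroupP; rewrite -/b -/q.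
suff [V [d [Vd xE]]] : exists V d : nat,
    [\/ V = (2 ^ (n + r))%N /\
        exists i, (1 <= i <= r)%N /\ (d + (n + r - i + 1) = 2 ^ (n + r))%N,
      V = q /\ exists j, (1 <= j <= n - 2)%N /\ (d + (n - j + 2) = q)%N
    | V = (q + 4)%N /\ d = q] /\ x = q.+1%:Z * V%:Z - d%:Z.
  by have /(maximal_two_bitsP _ _ hn hr) [? ? ? ?] := Vd; exists V, d; split.
have n_lt : (n < 2 ^ n)%N by apply: ltn_expl.
have B_gt : (n + r < 2 ^ (n + r))%N by apply: ltn_expl.
have q_gt : (2 ^ n + n + r < q)%N by rewrite /q /b two_bitsE; lia.
case: H => [[[i [ir ->]]|[j [jn ->]]]|->].
- exists (2 ^ (n + r))%N, (2 ^ (n + r) - (n + r - i + 1))%N.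
  have dE : (2 ^ (n + r) - (n + r - i + 1) + (n + r - i + 1) = 2 ^ (n + r))%N by lia.
  by split; [apply: Or31; split=> //; exists i|rewrite B1 // (VdN _ _ _ dE)].
- exists q, (q - (n - j + 2))%N.
  have dE : (q - (n - j + 2) + (n - j + 2) = q)%N by lia.
  by split; [apply: Or32; split=> //; exists j|rewrite B2 // (VdN _ _ _ dE)].
- exists (q + 4)%N, q.
  by split; [apply: Or33|rewrite B3 (VdN _ _ 4%N)].
Qed.
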